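(* Let $K$ be a field of characteristic zero, let $F(t)\in K[[t]]$ have constant term $1$, and let $(R_0,R_1,R_2,\dots)$ be the sprout sequence over $K$ with seed $F$. Define $b_1,b_2,\dots\in K$ by $\log F(t)=\sum_{n\ge1}b_n\frac{t^n}{n}$, and write $b_\alpha:=b_{\alpha_1}\cdots b_{\alpha_\ell}$ for a composition $\alpha=(\alpha_1,\dots,\alpha_\ell)$. Let $\phi_b$ be the algebra endomorphism of $\mathbf{NSym}$ with $\phi_b(\Psi_k)=b_k\Psi_k$ for all $k\ge1$, and let $\mathbf{R}_n:=\phi_b(S_n)$ (the canonical noncommutative lift of $R_n$). Then, for every $n$: (i) $\displaystyle \mathbf{R}_n=\sum_{\alpha\vDash n}\frac{b_\alpha}{\pi_u(\alpha)}\,\Psi^\alpha$, the sum being over all compositions $\alpha$ of $n$; (ii) $\chi(\mathbf{R}_n)=R_n$.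
   Context: A composition of $n\ge0$ (written $\alpha\vDash n$) is a (possibly empty) finite sequence $\alpha=(\alpha_1,\dots,\alpha_\ell)$ of positive integers with sum $n$; its partial sums are $s_j=\alpha_1+\dots+\alpha_j$, and $\pi_u(\alpha):=\prod_{j=1}^{\ell}s_j$ (empty products are $1$). $\Lambda_K$ is the $K$-algebra of symmetric functions in $x=(x_1,x_2,\dots)$, with complete homogeneous symmetric functions $h_n$. The sprout sequence $(R_0,R_1,\dots)$ with seed $F$ is defined by $\sum_{n\ge0}R_nt^n=\prod_{i\ge1}F(x_it)$; thus $R_n\in\Lambda_K$ is homogeneous of degree $n$. $\mathbf{NSym}=K\langle S_1,S_2,\dots\rangle$ is the free associative $K$-algebra on noncommuting generators $S_k$ of degree $k$, with $S_0:=1$. The noncommutative power sums of the first kind $\Psi_k$ ($k\ge1$) are defined recursively by $nS_n=\sum_{k=1}^{n}S_{n-k}\Psi_k$ for $n\ge1$. For a composition $\alpha=(\alpha_1,\dots,\alpha_\ell)$ put $\Psi^\alpha:=\Psi_{\alpha_1}\cdots\Psi_{\alpha_\ell}$, with $\Psi^\varnothing=1$. The $\Psi_k$ freely generate $\mathbf{NSym}$, so $\phi_b$ exists and is unique. $\chi:\mathbf{NSym}\to\Lambda_K$ is the $K$-algebra homomorphism with $\chi(S_n)=h_n$ for all $n\ge1$. *)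

(* Defs.v *)
From HB Require Import structures.
From mathcomp Require Import all_boot all_order all_algebra finmap.
From mathcomp.classical Require Import boolp classical_sets functions.
From mathcomp.classical Require Import cardinality fsbigop.
From mathcomp Require Import monalg.

Set Implicit Arguments.
Unset Strict Implicit.
Unset Printing Implicit Defensive.

Import GRing.Theory.
Local Open Scope ring_scope.

(* R[[t]]: [f n] is the coefficient of t^n. *)
Record fps (R : Type) := Fps { fps_coef : nat -> R }.
Coercion fps_coef : fps >-> Funclass.

HB.instance Definition _ (R : Type) := gen_eqMixin (fps R).
HB.instance Definition _ (R : Type) := gen_choiceMixin (fps R).

Lemma fpsP (R : Type) (f g : fps R) : f =1 g -> f = g.
Proof. by case: f g => f [g] /= /funext ->. Qed.

Section FpsRing.
Variable R : comNzRingType.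
Implicit Types f g h : fps R.

Definition fps_zero : fps R := Fps (fun=> 0).
Definition fps_opp f : fps R := Fps (fun n => - f n).
Definition fps_add f g : fps R := Fps (fun n => f n + g n).
Definition fps_one : fps R := Fps (fun n => (n == 0%N)%:R).
Definition fps_mul f g : fps R :=
  Fps (fun n => \sum_(i < n.+1) f i * g (n - i)%N).

Fact fps_addA : associative fps_add.
Proof. by move=> f g h; apply: fpsP => n; rewrite /= addrA. Qed.

Fact fps_addC : commutative fps_add.
Proof. by move=> f g; apply: fpsP => n; rewrite /= addrC. Qed.

Fact fps_add0 : left_id fps_zero fps_add.
Proof. by move=> f; apply: fpsP => n; rewrite /= add0r. Qed.

Fact fps_addN : left_inverse fps_zero fps_opp fps_add.
Proof. by move=> f; apply: fpsP => n; rewrite /= addNr. Qed.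

HB.instance Definition _ := GRing.isZmodule.Build (fps R)
  fps_addA fps_addC fps_add0 fps_addN.

Fact fps_mulC : commutative fps_mul.
Proof.
move=> f g; apply: fpsP => n /=; rewrite (reindex_inj rev_ord_inj) /=.
by apply: eq_bigr => i _; rewrite mulrC subSS subKn // -ltnS.
Qed.

Fact fps_mulA : associative fps_mul.
Proof.
move=> f g h; apply: fpsP => n; rewrite [fps_mul (fps_mul f g) h]fps_mulC /=.
pose c j k := f j * (g (n - j - k)%N * h k).
transitivity (\sum_(j < n.+1) \sum_(k < n.+1 | (k <= n - j)%N) c j k).
  apply: eq_bigr => /= j _.
  rewrite -[\sum_(i < _) g i * _]/(fps_mul g h (n - j)%N) fps_mulC /=.
  rewrite big_distrr /= (big_ord_narrow_leq (leq_subr _ _)).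
  by apply: eq_bigr => k _; rewrite /c /= [h k * _]mulrC.
rewrite (exchange_big_dep predT) //=; apply: eq_bigr => k _.
transitivity (\sum_(j < n.+1 | (j <= n - k)%N) c j k).
  apply: eq_bigl => j; rewrite -ltnS -(ltnS j) -!subSn ?leq_ord //.
  by rewrite -subn_gt0 -(subn_gt0 j) -!subnDA addnC.
rewrite (big_ord_narrow_leq (leq_subr _ _)) big_distrr /=.
apply: eq_bigr => j _.
by rewrite /c -!subnDA addnC mulrA [RHS]mulrC.
Qed.

Fact fps_mul1 : left_id fps_one fps_mul.
Proof.
move=> f; apply: fpsP => n /=; rewrite big_ord_recl mul1r subn0.
by rewrite big1 ?addr0 // => i _; rewrite mul0r.
Qed.

Fact fps_mulDl : left_distributive fps_mul fps_add.
Proof.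
move=> f g h; apply: fpsP => n /=; rewrite -big_split /=.
by apply: eq_bigr => i _; rewrite mulrDl.
Qed.

Fact fps_one_neq0 : fps_one != 0.
Proof.
apply/eqP => /(congr1 (fun f : fps R => f 0%N)) /= /eqP.
by rewrite oner_eq0.
Qed.

HB.instance Definition _ := GRing.Zmodule_isComNzRing.Build (fps R)
  fps_mulA fps_mulC fps_mul1 fps_mulDl fps_one_neq0.

End FpsRing.

(* log F = \sum_(k >= 1) (-1)^(k-1) (F - 1)^k / k.  When F has constant term 1,
   the terms with k > n do not contribute to the coefficient of t^n. *)
Definition fps_log (K : fieldType) (F : fps K) : fps K :=
  Fps (fun n =>
    \sum_(1 <= k < n.+1) (-1) ^+ k.-1 / k%:R * ((F - 1) ^+ k : fps K) n).

(* Formal power series over K in the commuting variables x_0, x_1, ...; the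
   monomials are the elements of {cmonom nat}. *)
Record xseries (K : Type) := XSeries { xcoef : {cmonom nat} -> K }.
Coercion xcoef : xseries >-> Funclass.

HB.instance Definition _ (K : Type) := gen_eqMixin (xseries K).
HB.instance Definition _ (K : Type) := gen_choiceMixin (xseries K).

Lemma xseriesP (K : Type) (f g : xseries K) : f =1 g -> f = g.
Proof. by case: f g => f [g] /= /funext ->. Qed.

Definition factors (m : {cmonom nat}) : set ({cmonom nat} * {cmonom nat}) :=
  [set p | mmul p.1 p.2 = m]%classic.

Definition covers (D : seq {cmonom nat}) (m : {cmonom nat}) :=
  forall a b : {cmonom nat}, mmul a b = m -> a \in D.

Lemma cmonom_split (m : {cmonom nat}) i : (0 < m i)%N ->
  exists m' : {cmonom nat}, mmul (ucm i) m' = m.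
Proof.
move=> mi; exists (divcm m (ucm i)); apply/eqP/cmP => j.
rewrite cmM divcmE cmU; case: eqVneq => [<-|_]; last by rewrite subn0.
by rewrite subnKC.
Qed.

Lemma cmonom_mulI (a : {cmonom nat}) : injective (mmul a).
Proof.
move=> b c /eqP/cmP e; apply/eqP/cmP => i.
by move: (e i); rewrite !cmM => /addnI.
Qed.

Lemma covers_ex m : exists2 D, uniq D & covers D m.
Proof.
suff [D Dm] : exists D, covers D m.
  exists (undup D); first exact: undup_uniq.
  by move=> a b ab; rewrite mem_undup (Dm a b).
have [n] := ubnP (mdeg m); elim: n m => // n IHn m.
case: (eqVneq (mdeg m) 0%N) => [m0 _|m0 le_mn].
  exists [:: mone] => a b abm; rewrite inE -mdeg_eq0.
  by move/(congr1 mdeg): abm; rewrite mdegM m0; case: (mdeg a).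
have [i mi] : exists i, (0 < m i)%N.
  apply/not_existsP => m_0; move: m0; rewrite mdeg_eq0 => /cmP[] i.
  by rewrite cm1; move: (m_0 i); case: (m i).
have [m' m'E] := cmonom_split mi.
have [|D Dm'] := IHn m'.
  by move: le_mn; rewrite -m'E mdegM mdegU.
exists (D ++ map (mmul (ucm i)) D) => a b abm; rewrite mem_cat.
case: (posnP (a i)) => [ai0|/cmonom_split [a' a'E]].
  have [|b' b'E] := @cmonom_split b i.
    by move: mi; rewrite -abm cmM ai0.
  apply/orP; left; apply: (Dm' a b'); apply: (@cmonom_mulI (ucm i)).
  by rewrite m'E -abm -b'E !mulmA; congr mmul; rewrite mulmC.
apply/orP; right; rewrite -a'E map_f //; apply: (Dm' a' b).
by apply: (@cmonom_mulI (ucm i)); rewrite m'E -abm -a'E !mulmA.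
Qed.

Lemma covers_dvd D m a b : covers D m -> mmul a b = m -> covers D a.
Proof.
by move=> Dm ab c d cda; apply: (Dm c (mmul d b)); rewrite mulmA cda.
Qed.

Section XSeriesRing.
Variable K : comNzRingType.
Implicit Types f g h : xseries K.

Definition xs_zero : xseries K := XSeries (fun=> 0).
Definition xs_opp f : xseries K := XSeries (fun m => - f m).
Definition xs_add f g : xseries K := XSeries (fun m => f m + g m).
Definition xs_one : xseries K := XSeries (fun m => (m == mone)%:R).
(* [factors m] is finite (see [xs_mulE]), so the sum below is a genuine one. *)
Definition xs_mul f g : xseries K :=
  XSeries (fun m => \sum_(p \in factors m) f p.1 * g p.2).
Definition xs_scale (c : K) f : xseries K := XSeries (fun m => c * f m).

Lemma xs_mulE D m f g : uniq D -> covers D m ->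
  xs_mul f g m = \sum_(a <- D) \sum_(b <- D | mmul a b == m) f a * g b.
Proof.
move=> uD Dm /=; pose s := [seq p <- allpairs pair D D | mmul p.1 p.2 == m].
rewrite (fsbig_fwiden s).
- rewrite big_filter big_mkcond big_allpairs.
  by apply: eq_bigr => a _; rewrite -big_mkcond.
- move=> [a b] /= abm; rewrite mem_filter /= abm eqxx allpairs_f //.
    exact: Dm abm.
  by apply: (Dm b a); rewrite mulmC.
- by rewrite filter_uniq // allpairs_uniq // => -[a b] [c d].
- by move=> [a b] /= [+ abm]; rewrite mem_filter => /andP[/eqP].
Qed.

Fact xs_addA : associative xs_add.
Proof. by move=> f g h; apply: xseriesP => m; rewrite /= addrA. Qed.

Fact xs_addC : commutative xs_add.
Proof. by move=> f g; apply: xseriesP => m; rewrite /= addrC. Qed.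

Fact xs_add0 : left_id xs_zero xs_add.
Proof. by move=> f; apply: xseriesP => m; rewrite /= add0r. Qed.

Fact xs_addN : left_inverse xs_zero xs_opp xs_add.
Proof. by move=> f; apply: xseriesP => m; rewrite /= addNr. Qed.

HB.instance Definition _ := GRing.isZmodule.Build (xseries K)
  xs_addA xs_addC xs_add0 xs_addN.

Fact xs_mulC : commutative xs_mul.
Proof.
move=> f g; apply: xseriesP => m; have [D uD Dm] := covers_ex m.
rewrite !(xs_mulE _ _ uD Dm) (exchange_big_dep predT) //=.
apply: eq_bigr => a _; apply: eq_big => [b|b _]; last by rewrite mulrC.
by rewrite mulmC.
Qed.

Fact xs_mulA : associative xs_mul.
Proof.
have key f g h m D : uniq D -> covers D m -> xs_mul (xs_mul f g) h m =
    \sum_(a <- D) \sum_(b <- D) \sum_(c <- D)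
      if mmul (mmul a b) c == m then f a * g b * h c else 0.
  move=> uD Dm; rewrite (xs_mulE _ _ uD Dm).
  transitivity (\sum_(p <- D) \sum_(c <- D | mmul p c == m) \sum_(a <- D)
      \sum_(b <- D | mmul a b == p) f a * g b * h c).
    apply: eq_bigr => p _; apply: eq_bigr => c /eqP pcm.
    rewrite (xs_mulE _ _ uD (covers_dvd Dm pcm)) big_distrl /=.
    by apply: eq_bigr => a _; rewrite big_distrl.
  under eq_bigr do rewrite exchange_big.
  rewrite exchange_big; apply: eq_bigr => a _ /=.
  under eq_bigr do rewrite (exchange_big_dep predT) //=.
  rewrite exchange_big; apply: eq_bigr => b _ /=.
  under eq_bigr do rewrite big_mkcond /=.
  rewrite exchange_big; apply: eq_bigr => c _ /=.
  case: eqP => [abcm|abcm].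
    rewrite (bigD1_seq (mmul a b)) //=; last exact: Dm abcm.
    rewrite abcm eqxx big_seq_cond eqxx big1 ?addr0 // => p /andP[_ pab].
    by rewrite [_ == p]eq_sym (negPf pab) andbF.
  rewrite big1 // => p _; case: ifP => // /andP[/eqP pcm /eqP abp].
  by case: abcm; rewrite abp.
move=> f g h; apply: xseriesP => m; have [D uD Dm] := covers_ex m.
rewrite [xs_mul f _]xs_mulC !(key _ _ _ _ _ uD Dm).
under eq_bigr do rewrite exchange_big.
rewrite exchange_big; apply: eq_bigr => a _; apply: eq_bigr => b _.
apply: eq_bigr => c _.
by rewrite [mmul (mmul b c) a]mulmC mulmA mulrC mulrA.
Qed.

Fact xs_mul1 : left_id xs_one xs_mul.
Proof.
move=> f; apply: xseriesP => m; have [D uD Dm] := covers_ex m.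
rewrite (xs_mulE _ _ uD Dm) (bigD1_seq mone) //=; last first.
  by apply: (Dm mone m); rewrite mul1m.
rewrite [X in _ + X]big1 => [|a a1]; last first.
  by rewrite big1 // => b _; rewrite (negPf a1) mul0r.
rewrite addr0 big_mkcond (bigD1_seq m) //=; last first.
  by apply: (Dm m mone); rewrite mulm1.
rewrite mul1m !eqxx mul1r big1 ?addr0 // => b bm.
by rewrite mul1m (negPf bm).
Qed.

Fact xs_mulDl : left_distributive xs_mul xs_add.
Proof.
move=> f g h; apply: xseriesP => m; have [D uD Dm] := covers_ex m.
rewrite -[RHS]/(xs_mul f h m + xs_mul g h m) !(xs_mulE _ _ uD Dm) -big_split /=; apply: eq_bigr => a _.
by rewrite -big_split /=; apply: eq_bigr => b _; rewrite mulrDl.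
Qed.

Fact xs_one_neq0 : xs_one != 0.
Proof.
apply/eqP => /(congr1 (fun f : xseries K => f mone)) /= /eqP.
by rewrite eqxx oner_eq0.
Qed.

HB.instance Definition _ := GRing.Zmodule_isComNzRing.Build (xseries K)
  xs_mulA xs_mulC xs_mul1 xs_mulDl xs_one_neq0.

Fact xs_scaleA c d f : xs_scale c (xs_scale d f) = xs_scale (c * d) f.
Proof. by apply: xseriesP => m; rewrite /= mulrA. Qed.

Fact xs_scale1 : left_id 1 xs_scale.
Proof. by move=> f; apply: xseriesP => m; rewrite /= mul1r. Qed.

Fact xs_scaleDr : right_distributive xs_scale +%R.
Proof. by move=> c f g; apply: xseriesP => m; rewrite /= mulrDr. Qed.

Fact xs_scaleDl f : {morph xs_scale^~ f : c d / c + d}.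
Proof. by move=> c d; apply: xseriesP => m; rewrite /= mulrDl. Qed.

HB.instance Definition _ := GRing.Zmodule_isLmodule.Build K (xseries K)
  xs_scaleA xs_scale1 xs_scaleDr xs_scaleDl.

Fact xs_scaleAl (c : K) f g : c *: (f * g) = c *: f * g.
Proof.
apply: xseriesP => m; have [D uD Dm] := covers_ex m.
rewrite [LHS]/= -[\sum_(p \in _) _]/(xs_mul f g m).
rewrite -[RHS]/(xs_mul (xs_scale c f) g m) !(xs_mulE _ _ uD Dm) big_distrr.
apply: eq_bigr => a _; rewrite big_distrr /=.
by apply: eq_bigr => b _; rewrite mulrA.
Qed.

HB.instance Definition _ := GRing.Lmodule_isLalgebra.Build K (xseries K)
  xs_scaleAl.
HB.instance Definition _ := GRing.Lalgebra_isComAlgebra.Build K (xseries K).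

Definition xvar (i : nat) : xseries K := XSeries (fun m => (m == ucm i)%:R).

End XSeriesRing.

Arguments xvar {K} i.

Section Symmetric.
Variable K : comNzRingType.
Implicit Types f g : xseries K.

(* Invariance under permutations of the variables: m' is the monomial obtained
   from m by permuting the exponents along s. *)
Definition xsymmetric f :=
  forall (s : nat -> nat) (m m' : {cmonom nat}), bijective s ->
    (forall i, m' i = m (s i)) -> f m' = f m.

Definition bounded_degree f :=
  exists d : nat, forall m : {cmonom nat}, (d < mdeg m)%N -> f m = 0.

Definition symfun_pred : {pred xseries K} :=
  [pred f | `[< xsymmetric f /\ bounded_degree f >]].

Lemma symfunP f :
  reflect (xsymmetric f /\ bounded_degree f) (f \in symfun_pred).
Proof. exact: asboolP. Qed.

Definition ren (s s' : nat -> nat) (m : {cmonom nat}) : {cmonom nat} :=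
  [cmonom m (s i) | i in [fset s' j | j in finsupp m]%fset]%M.

Lemma renE s s' m i : cancel s s' -> ren s s' m i = m (s i).
Proof.
move=> sK; rewrite /ren cmE fsfun_fun; case: ifPn => // si.
apply/esym/eqP; rewrite cmE_eq0; apply: contra si => si.
by apply/imfsetP; exists (s i) => //; rewrite sK.
Qed.

Lemma xsymmetricM f g : xsymmetric f -> xsymmetric g -> xsymmetric (f * g).
Proof.
move=> fS gS s m m' sB m'E; have [s' sK s'K] := sB.
have r1 x : ren s s' (ren s' s x) = x.
  by apply/eqP/cmP => i; rewrite !renE // sK.
have r2 x : ren s' s (ren s s' x) = x.
  by apply/eqP/cmP => i; rewrite !renE // s'K.
have rM x y : ren s s' (mmul x y) = mmul (ren s s' x) (ren s s' y).
  by apply/eqP/cmP => i; rewrite !(renE, cmM).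
have {m'E} -> : m' = ren s s' m.
  by apply/eqP/cmP => i; rewrite renE.
rewrite /GRing.mul /=.
rewrite (reindex_fsbig (fun p => (ren s s' p.1, ren s s' p.2)) (factors m)) /=.
  apply: eq_fsbigr => -[a b] _ /=; congr (_ * _).
    by apply: (fS s) => // i; rewrite renE.
  by apply: (gS s) => // i; rewrite renE.
split.
- by move=> [a b] /= <-; rewrite /factors /= rM.
- move=> [a b] [c d] _ _ /= [/(congr1 (ren s' s)) + /(congr1 (ren s' s))].
  by rewrite !r2 => -> ->.
- move=> [a b] /= abm; exists (ren s' s a, ren s' s b); rewrite /= ?r1 //.
  by rewrite /factors /= -[LHS]r2 rM !r1 abm.
Qed.

Lemma bounded_degreeM f g :
  bounded_degree f -> bounded_degree g -> bounded_degree (f * g).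
Proof.
move=> [d fd] [e ge]; exists (d + e)%N => m dem.
rewrite /GRing.mul /= fsbig1 // => -[a b] /= abm.
move: dem; rewrite -abm mdegM => dem.
case: (ltnP d (mdeg a)) => [/fd -> |ad]; first by rewrite mul0r.
rewrite [g b]ge ?mulr0 // -(ltn_add2l d) (leq_trans dem) //.
by rewrite leq_add2r.
Qed.

Fact symfun_subalg : subalg_closed symfun_pred.
Proof.
split.
- apply/symfunP; split; last first.
    by exists 0%N => m; rewrite /= lt0n mdeg_eq0 => /negPf ->.
  move=> s m m' [s' sK s'K] m'E /=; congr (_ %:R); congr nat_of_bool.
  apply/cmP/cmP => m1 i; rewrite cm1; last by rewrite m'E m1 cm1.
  by rewrite -[i]s'K -m'E m1 cm1.
- move=> c f g /symfunP[fS [d fd]] /symfunP[gS [e ge]]; apply/symfunP; split.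
    by move=> s m m' sB m'E /=; rewrite (fS _ _ _ sB m'E) (gS _ _ _ sB m'E).
  exists (maxn d e) => m; rewrite gtn_max => /andP[dm em] /=.
  by rewrite fd // ge // mulr0 addr0.
- move=> f g /symfunP[fS fB] /symfunP[gS gB]; apply/symfunP.
  by split; [exact: xsymmetricM | exact: bounded_degreeM].
Qed.

HB.instance Definition _ :=
  GRing.isSubalgClosed.Build K (xseries K) symfun_pred symfun_subalg.

(* Lambda_K: the symmetric series of bounded degree. *)
Record symfun := SymFun { symval : xseries K; _ : symval \in symfun_pred }.

HB.instance Definition _ := [isSub for symval].
HB.instance Definition _ := [Choice of symfun by <:].
HB.instance Definition _ := [SubChoice_isSubComNzRing of symfun by <:].
HB.instance Definition _ := [SubZmodule_isSubLmodule of symfun by <:].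
HB.instance Definition _ := [SubNzRing_SubLmodule_isSubLalgebra of symfun by <:].

Fact hsym_subproof n :
  XSeries (fun m => (mdeg m == n)%:R) \in symfun_pred.
Proof.
apply/symfunP; split; last first.
  by exists n => m; rewrite /= ltn_neqAle eq_sym => /andP[/negPf ->].
move=> s m m' sB m'E /=; congr (_ == _)%:R; have [s' sK s'K] := sB.
have -> : m' = ren s s' m by apply/eqP/cmP => i; rewrite renE.
rewrite (@mdegEw _ _ [fset s' j | j in finsupp m]%fset); last first.
  apply/fsubsetP => i; rewrite -cmE_neq0 renE // cmE_neq0 => si.
  by apply/imfsetP; exists (s i) => //; rewrite sK.
rewrite mdegE big_imfset /=; last by move=> i j _ _ /(can_inj s'K).
by apply: eq_bigr => i _; rewrite renE // s'K.
Qed.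

(* The complete homogeneous symmetric function h_n: the sum of all monomials
   of degree n. *)
Definition hsym (n : nat) : symfun := SymFun (hsym_subproof n).

End Symmetric.

(* NSym = K<S_1, S_2, ...>: the monoid algebra of the free monoid on nat, the
   letter k standing for S_(k+1). *)
Notation NSym K := {malg K[{fmonom nat}]}.

Section NSymDefs.
Variable K : fieldType.

Definition nsymS (n : nat) : NSym K :=
  if n is k.+1 then mkmalgU (fmu k) 1 else 1.

(* [:: Psi_1; ...; Psi_n] *)
Fixpoint nsymPsi_seq (n : nat) : seq (NSym K) :=
  if n is k.+1 then
    let s := nsymPsi_seq k in
    rcons s (n%:R *: nsymS n - \sum_(j < k) nsymS (k - j) * s`_j)
  else [::].

(* The value of nsymPsi at 0 is irrelevant. *)
Definition nsymPsi (n : nat) : NSym K := (nsymPsi_seq n)`_n.-1.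

Lemma nsymPsiE (n : nat) : (0 < n)%N ->
  n%:R *: nsymS n = \sum_(1 <= k < n.+1) nsymS (n - k) * nsymPsi k.
Proof.
have sz k : size (nsymPsi_seq k) = k.
  by elim: k => //= k IHk; rewrite size_rcons IHk.
have nthP k j : (j < k)%N -> (nsymPsi_seq k)`_j = nsymPsi j.+1.
  elim: k => // k IHk jk; rewrite /= nth_rcons sz.
  case: ltnP => [/IHk //|kj].
  have -> : j = k by apply/eqP; rewrite eqn_leq kj -ltnS jk.
  by rewrite eqxx /nsymPsi /= nth_rcons sz ltnn eqxx.
case: n => // n _; rewrite big_add1 /= big_nat_recr //= subnn mul1r.
rewrite [X in _ = _ + X]/nsymPsi /= nth_rcons sz ltnn eqxx big_mkord.
rewrite [X in _ = X + _](eq_bigr (fun j : 'I_n =>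
  nsymS (n - j) * (nsymPsi_seq n)`_j)) => [|j _]; last by rewrite nthP ?subSS.
by rewrite addrC subrK.
Qed.

(* Psi^alpha and b_alpha *)
Definition nsymPsi_comp (a : seq nat) : NSym K := \prod_(k <- a) nsymPsi k.
Definition comp_coef (b : nat -> K) (a : seq nat) : K := \prod_(k <- a) b k.

End NSymDefs.

Arguments nsymS {K} n.
Arguments nsymPsi {K} n.
Arguments nsymPsi_comp {K} a.

Definition compositions (n : nat) : set (seq nat) :=
  [set a | all (leq 1) a /\ sumn a = n]%classic.

Lemma finite_compositions n : finite_set (compositions n).
Proof.
have [r rE] : exists r : seq nat, forall k, (k <= n)%N -> k \in r.
  by exists (iota 0 n.+1) => k kn; rewrite mem_iota.
pose fix L p : seq (seq nat) := if p is q.+1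
  then [::] :: flatten [seq map (cons k) (L q) | k <- r] else [:: [::]].
have inL p (a : seq nat) : (size a <= p)%N -> all (leq^~ n) a -> a \in L p.
  elim: p a => [|p IHp] [|k a] //= sa /andP[kn an]; rewrite inE.
  apply/orP; right; apply/flatten_mapP.
  by exists k; [exact: rE | rewrite mem_map ?IHp // => x y []].
apply: (@sub_finite_set _ _ [set` L n]); last exact: finite_seq.
move=> a [a1 an] /=; apply: inL; rewrite -an.
  by elim: a a1 {an} => //= k a IHa /andP[k1 /IHa ka]; rewrite -add1n leq_add.
apply/allP => k /=; elim: a {a1 an} => //= j a IHa; rewrite inE.
case/predU1P => [->|/IHa ka]; first exact: leq_addr.
by apply: leq_trans ka _; exact: leq_addl.
Qed.

Definition pi_u (a : seq nat) : nat :=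
  (\prod_(1 <= j < (size a).+1) sumn (take j a))%N.

(* F(x_i t), as a power series in t over K[[x_0, x_1, ...]] *)
Definition sprout_factor (K : fieldType) (F : fps K) (i : nat) :
    fps (xseries K) :=
  Fps (fun n => F n *: xvar i ^+ n).

(* \sum_n R_n t^n = \prod_i F(x_i t): for all n and all monomials m, the
   coefficient of t^n x^m in the partial products is eventually that of R_n. *)
Definition is_sprout (K : fieldType) (F : fps K) (R : nat -> symfun K) :=
  forall (n : nat) (m : {cmonom nat}), exists N0 : nat,
    forall N : nat, (N0 <= N)%N ->
      (\prod_(i < N) sprout_factor F i) n m = symval (R n) m.

(* Main.v *)
Require Import Defs.
From HB Require Import structures.
From mathcomp Require Import all_boot all_order all_algebra finmap.
From mathcomp.classical Require Import boolp classical_sets functions.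
From mathcomp.classical Require Import cardinality fsbigop.
From mathcomp Require Import monalg.

Set Implicit Arguments.
Unset Strict Implicit.
Unset Printing Implicit Defensive.

Import GRing.Theory.
Local Open Scope ring_scope.

(** The theorem compares solutions of Newton-type recursions
      n u_n = sum over 1 <= k <= n of u_(n-k) q_k,
    which, in characteristic zero, determine u from u_0 and q.

    In NSym the recursion with q_k = Psi_k defines the Psi_k from the S_n;
    applying phi turns it into the recursion with q_k = b_k Psi_k for the lifts
    phi(S_n).  The sums over compositions in (i) solve the same recursion: a
    composition of n is obtained in exactly one way by appending a last part k
    to a composition of n - k, which multiplies b_alpha by b_k, pi_u by n (the
    last partial sum) and Psi^alpha by Psi_k on the right
    ([newton_rec_comp_sum]).

    For (ii), let D = t d/dt.  Since log F has coefficients b_n / n, the series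
    B = D (log F) = sum of b_n t^n satisfies D F = B F ([fps_euler_log]).  The
    Leibniz rule then gives, for the product of the F(x_i t) over i < N, the
    recursion with q_k = b_k (x_0^k + ... + x_(N-1)^k)
    ([newton_rec_sprout_prod]).  Letting N go to infinity coefficientwise shows
    that the R_n satisfy the recursion with q_k = b_k p_k, where p_k is the
    limit of the power sums.  That this limit exists and equals chi(Psi_k) comes
    from the case F = 1 / (1 - t): there b_k = 1, the sprout sequence is h_n
    ([hsym_sprout]), and the recursion can be solved for its coefficients q_k,
    so that the limits of the h_n force those of the power sums
    ([newton_rec_xs_lim]).  Hence chi(phi(S_n)) and R_n satisfy the same
    recursion. *)

(** * Newton recursions *)

(** The coefficients stand on the right of the unknowns because NSym is not
    commutative. *)
Definition newton_rec (K : fieldType) (A : lalgType K) (u q : nat -> A) :=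
  forall n, (0 < n)%N ->
    n%:R *: u n = \sum_(1 <= k < n.+1) u (n - k)%N * q k.

Lemma pchar0_natr_neq0 (K : fieldType) : [pchar K] =i pred0 ->
  forall n, (0 < n)%N -> n%:R != 0 :> K.
Proof. by move=> /pcharf0P charK [|n] // _; rewrite charK. Qed.

Lemma newton_rec_unique (K : fieldType) (A : lalgType K) (u v q : nat -> A) :
  [pchar K] =i pred0 -> u 0%N = v 0%N ->
  newton_rec u q -> newton_rec v q -> u =1 v.
Proof.
move=> charK uv0 uq vq n; have [p] := ubnP n; elim: p n => // p IHp [//|n] np.
apply: (scalerI (pchar0_natr_neq0 charK (ltn0Sn n))).
rewrite uq // vq //; apply: eq_big_nat => k /andP[k0 kn].
by rewrite IHp // (leq_trans _ (ltnSE np)) // ltn_subrL k0.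
Qed.

(** Stated for a scalable ring morphism, so that it applies both to chi and
    phi and to the embedding of the symmetric functions into the series. *)
Lemma newton_rec_rmorph (K : fieldType) (A B : lalgType K)
    (f : {rmorphism A -> B}) (u q : nat -> A) :
  scalable f -> newton_rec u q -> newton_rec (f \o u) (f \o q).
Proof.
move=> fZ uq n n0; rewrite /= -fZ uq // rmorph_sum /=.
by apply: eq_bigr => k _; rewrite rmorphM.
Qed.

Lemma eq_newton_rec (K : fieldType) (A : lalgType K) (u q q' : nat -> A) :
  (forall k, (0 < k)%N -> q k = q' k) -> newton_rec u q -> newton_rec u q'.
Proof.
move=> qq uq n n0; rewrite uq //; apply: eq_big_nat => k /andP[k0 _].
by rewrite qq.
Qed.

(** * Sums over compositions *)

Lemma compositionsS_rcons n k (a : seq nat) :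
  (0 < k <= n.+1)%N ->
  (all (leq 1) (rcons a k) /\ sumn (rcons a k) = n.+1) <->
  (all (leq 1) a /\ sumn a = (n.+1 - k)%N).
Proof.
move=> /andP[k0 kn]; rewrite all_rcons k0 sumn_rcons /=.
split=> -[a1 an]; split=> //; first by rewrite -an addnK.
by rewrite an subnK.
Qed.

Lemma fsum_compositions (V : nmodType) n (f : seq nat -> V) :
  \sum_(a \in compositions n) f a = \sum_(a <- fset_set (compositions n)) f a.
Proof. by rewrite fsbig_finite //; exact: finite_compositions. Qed.

(** A composition of a positive integer is a composition of a smaller one with
    a last part appended, and this last part is determined by it. *)
Lemma fsum_compositionsS (V : nmodType) n (f : seq nat -> V) :
  \sum_(a \in compositions n.+1) f a =
  \sum_(1 <= k < n.+2) \sum_(a \in compositions (n.+1 - k)) f (rcons a k).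
Proof.
have inC m a : (a \in fset_set (compositions m)) = (a \in compositions m).
  by rewrite in_fset_set //; exact: finite_compositions.
rewrite fsum_compositions.
transitivity (\sum_(a <- fset_set (compositions n.+1))
   \sum_(1 <= k < n.+2) if last 0%N a == k then f a else 0).
  apply: eq_big_seq => a; rewrite inC inE => -[a1 an].
  (* Only k = last part of a contributes to the inner sum. *)
  rewrite -big_mkcond /= -big_filter.
  suff -> : [seq i <- index_iota 1 n.+2 | last 0%N a == i] = [:: last 0%N a].
    by rewrite big_seq1.
  have -> : [seq i <- index_iota 1 n.+2 | last 0%N a == i] =
      [seq i <- index_iota 1 n.+2 | pred1 (last 0%N a) i].
    by apply: eq_filter => i /=; rewrite eq_sym.
  rewrite filter_pred1_uniq ?iota_uniq // mem_index_iota.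
  elim/last_ind: a a1 an => // a k _.
  rewrite last_rcons all_rcons sumn_rcons => /andP[-> _] <-.
  by rewrite ltnS leq_addl.
rewrite exchange_big; apply: eq_big_nat => k kn.
rewrite fsum_compositions.
rewrite -big_mkcond -big_filter /=.
rewrite -(big_map (rcons^~ k) xpredT f); apply: perm_big; apply: uniq_perm.
- by rewrite filter_uniq ?fset_uniq.
- by rewrite map_inj_uniq ?fset_uniq // => a c /rcons_inj[].
move=> a; rewrite mem_filter inC; apply/andP/mapP.
- case=> /eqP ak; rewrite inE; case/lastP: a ak => [|a j]; first by move=> _ [].
  rewrite last_rcons => -> /(compositionsS_rcons _ kn) ac.
  by exists a => //; rewrite inC inE.
- case=> c; rewrite inC inE => cc ->; rewrite last_rcons eqxx; split=> //.
  by rewrite inE; apply/compositionsS_rcons.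
Qed.

Lemma pi_u_rcons (a : seq nat) k :
  pi_u (rcons a k) = (pi_u a * (sumn a + k))%N.
Proof.
rewrite /pi_u size_rcons big_nat_recr //= -{2}(size_rcons a k) take_size.
rewrite sumn_rcons; congr (_ * _)%N; apply: eq_big_nat => j /andP[_ ja].
by rewrite -cats1 takel_cat.
Qed.

Definition comp_sum (K : fieldType) (b : nat -> K) (n : nat) : NSym K :=
  \sum_(a \in compositions n) (comp_coef b a / (pi_u a)%:R) *: nsymPsi_comp a.

Lemma comp_sum0 (K : fieldType) (b : nat -> K) : comp_sum b 0 = 1.
Proof.
have C0 : compositions 0 = [set [::]]%classic.
  apply/seteqP; split=> [a|_ ->] //=.
  by case: a => // k a [] /= /andP[k0 _] /eqP; rewrite addn_eq0 eqn0Ngt k0.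
rewrite /comp_sum C0 fsbig_set1 /comp_coef /nsymPsi_comp /pi_u !big_nil.
by rewrite divr1 scale1r.
Qed.

Lemma malg_scalerAr (M : monomType) (K : comNzRingType) (c : K)
    (f g : {malg K[M]}) : f * (c *: g) = c *: (f * g).
Proof.
apply/malgP => m; rewrite (mcoeffMlw m (fsubset_refl _) (msuppZ_le c g)).
rewrite mcoeffZ mcoeffMl mulr_sumr.
apply: eq_bigr => i _; rewrite mulr_sumr; apply: eq_bigr => j _.
by rewrite mcoeffZ mulrCA mulrnAr.
Qed.

Lemma malg_scalerM (M : monomType) (K : comNzRingType) (c d : K)
    (f g : {malg K[M]}) : (c *: f) * (d *: g) = (c * d) *: (f * g).
Proof. by rewrite -scalerAl malg_scalerAr scalerA. Qed.

(** Appending a last part [k] multiplies [pi_u] by the full sum [n]; this is the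
    factor [n] on the left of the recursion. *)
Lemma newton_rec_comp_sum (K : fieldType) (b : nat -> K) :
  [pchar K] =i pred0 ->
  newton_rec (comp_sum b) (fun k => b k *: nsymPsi k).
Proof.
move=> charK [//|n] _.
have coefE (x y : K) p : n.+1%:R * (x * y / (p * n.+1)%:R) = x / p%:R * y.
  rewrite natrM invfM mulrC -!mulrA mulVf ?mulr1 ?pchar0_natr_neq0 //.
  by rewrite [y * _]mulrC.
rewrite [in LHS]/comp_sum fsum_compositionsS scaler_sumr.
apply: eq_big_nat => k /andP[k0 kn].
rewrite fsum_compositions [comp_sum _ _]fsum_compositions.
rewrite scaler_sumr mulr_suml; apply: eq_big_seq => a.
rewrite in_fset_set; last exact: finite_compositions.
rewrite inE => -[_ an].
rewrite pi_u_rcons an subnK // /comp_coef /nsymPsi_comp -cats1 !big_cat.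
by rewrite !big_seq1 malg_scalerM [LHS]scalerA coefE.
Qed.

(** * The Euler derivation of power series *)

Section FpsTheory.
Variable R : comNzRingType.
Implicit Types f g u : fps R.

(** The coefficients of a series as a named function, which can carry the
    structure of an additive map. *)
Definition fps_nth (n : nat) f : R := f n.

Fact fps_nth_additive n : additive (fps_nth n).
Proof. by []. Qed.

HB.instance Definition _ n :=
  GRing.isAdditive.Build (fps R) R (fps_nth n) (fps_nth_additive n).

Lemma fps_mulE f g n : (f * g) n = \sum_(i < n.+1) f i * g (n - i)%N.
Proof. by []. Qed.

(** The derivation t d/dt: unlike d/dt it keeps the degree, so that F(x_i t)
    needs no factor x_i from the chain rule. *)
Definition fps_euler f : fps R := Fps (fun n => n%:R * f n).

Lemma fps_eulerM f g : fps_euler (f * g) = fps_euler f * g + f * fps_euler g.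
Proof.
apply: fpsP => n.
rewrite /= mulr_sumr -big_split; apply: eq_bigr => i _ /=.
by rewrite -mulrA [X in _ + X]mulrCA -mulrDl -natrD subnKC // -ltnS.
Qed.

Lemma fps_euler1 : fps_euler 1 = 0.
Proof. by apply: fpsP => -[|n] /=; rewrite ?mul0r ?mulr0. Qed.

Lemma fps_eulerX u k : fps_euler (u ^+ k.+1) = (u ^+ k * fps_euler u) *+ k.+1.
Proof.
elim: k => [|k IHk]; first by rewrite mul1r.
rewrite exprS fps_eulerM IHk mulrnAr mulrA -exprS.
by rewrite [fps_euler u * _]mulrC -mulrS.
Qed.

Lemma fps_nthX_small u k n : u 0%N = 0 -> (n < k)%N -> (u ^+ k) n = 0.
Proof.
move=> u0; elim: k n => // k IHk n nk.
rewrite exprS fps_mulE big1 // => -[[|i] ni] _ /=.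
  by rewrite u0 mul0r.
by rewrite IHk ?mulr0 // ltn_subLR // (leq_trans nk) // addSn ltnS leq_addl.
Qed.

(** The logarithmic derivative of a product is the sum of the logarithmic
    derivatives of the factors. *)
Lemma fps_euler_prod (I : Type) (r : seq I) (B f : I -> fps R) :
  (forall i, fps_euler (f i) = B i * f i) ->
  fps_euler (\prod_(i <- r) f i) = (\sum_(i <- r) B i) * \prod_(i <- r) f i.
Proof.
move=> fB; elim: r => [|i r IHr]; first by rewrite !big_nil mul0r fps_euler1.
rewrite !big_cons fps_eulerM IHr fB mulrDl -mulrA.
by congr (_ + _); rewrite mulrCA.
Qed.

Lemma fps_prod0 (I : Type) (r : seq I) (f : I -> fps R) :
  (forall i, f i 0%N = 1) -> (\prod_(i <- r) f i) 0%N = 1.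
Proof.
move=> f0; elim: r => [|i r IHr]; first by rewrite big_nil.
by rewrite big_cons fps_mulE big_ord1 f0 IHr mulr1.
Qed.

End FpsTheory.

(** With u = F - 1, the derivative of the logarithm is, up to degree n, the
    truncated geometric series in - u times the derivative of u; multiplying by
    F = 1 + u telescopes it to (1 - (- u)^(n+1)) times that derivative, and the
    error term has no coefficient in degree n. *)
Lemma fps_euler_log (K : fieldType) (F : fps K) :
  [pchar K] =i pred0 -> F 0%N = 1 ->
  fps_euler F = fps_euler (fps_log F) * F.
Proof.
move=> charK F0; apply: fpsP => n.
pose u := F - 1; have u0 : u 0%N = 0 by rewrite /= F0 subrr.
have -> : fps_euler F = fps_euler u.
  by apply: fpsP => -[|m] /=; rewrite ?mul0r ?subr0.
have term j k : (-1) ^+ j / j.+1%:R * (k%:R * (u ^+ j.+1) k) =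
    ((- u) ^+ j * fps_euler u) k.
  rewrite -[k%:R * _]/(fps_nth k (fps_euler (u ^+ j.+1))) fps_eulerX raddfMn.
  rewrite -[fps_nth k _ *+ _]mulr_natl mulrA mulfVK ?pchar0_natr_neq0 //.
  rewrite [in RHS]exprNn -mulrA -[RHS]/(fps_nth k ((-1) ^+ j * _)).
  by rewrite raddfMsign.
(* The cut-off of the logarithm in degree k may be moved up to n: the powers of
   u beyond the k-th have no coefficient in degree k. *)
have coefL k : (k <= n)%N -> fps_euler (fps_log F) k =
    ((\sum_(0 <= j < n.+1) (- u) ^+ j) * fps_euler u) k.
  move=> kn; rewrite mulr_suml -[RHS]/(fps_nth k _) raddf_sum.
  rewrite [RHS](big_cat_nat (n := k)) ?leqW //.
  rewrite [X in _ = _ + X]big_nat_cond [X in _ = _ + X]big1 ?addr0; last first.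
    move=> j /andP[/andP[kj _] _].
    rewrite -[LHS]/(((- u) ^+ j * fps_euler u) k) -term.
    by rewrite fps_nthX_small ?mulr0 // ltnS.
  rewrite [LHS]/= big_add1 mulr_sumr; apply: eq_bigr => j _.
  by rewrite -[RHS]/(((- u) ^+ j * fps_euler u) k) -term mulrCA.
rewrite fps_mulE.
under eq_bigr => i _ do rewrite coefL -1?ltnS //.
rewrite -fps_mulE mulrAC.
have -> : (\sum_(0 <= j < n.+1) (- u) ^+ j) * F = 1 - (- u) ^+ n.+1.
  have FE : F = - (- u - 1) by rewrite /u !opprB subrKC.
  by rewrite big_mkord mulrC {1}FE mulNr -subrX1 opprB.
rewrite mulrBl mul1r.
rewrite -[RHS]/(fps_euler u n - ((- u) ^+ n.+1 * fps_euler u) n).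
rewrite fps_mulE big1 ?subr0 // => i _.
rewrite fps_nthX_small ?mul0r //.
by rewrite -[LHS]/(- u 0%N) u0 oppr0.
Qed.

(** * Pointwise limits of series in the variables *)

Section XsLim.
Variable K : comNzRingType.
Implicit Types (u v : nat -> xseries K) (f g l : xseries K).

(** Coefficientwise convergence for the discrete topology on [K]. *)
Definition xs_lim u l := forall m : {cmonom nat}, exists N0 : nat,
  forall N : nat, (N0 <= N)%N -> u N m = l m.

Lemma xs_lim_seq u l (s : seq {cmonom nat}) : xs_lim u l ->
  exists N0 : nat, forall N, (N0 <= N)%N -> {in s, u N =1 l}.
Proof.
move=> ul; elim: s => [|m s [N0 IHs]]; first by exists 0%N.
have [N1 ulm] := ul m; exists (maxn N0 N1) => N.
rewrite geq_max => /andP[N0N N1N].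
by move=> m'; rewrite inE => /predU1P[->|/(IHs N N0N)//]; exact: ulm.
Qed.

Lemma xs_lim_unique u f g : xs_lim u f -> xs_lim u g -> f = g.
Proof.
move=> uf ug; apply: xseriesP => m.
have [N1 ufm] := uf m; have [N2 ugm] := ug m.
by rewrite -(ufm (maxn N1 N2)) ?leq_maxl // ugm ?leq_maxr.
Qed.

Lemma xs_lim_cst f : xs_lim (fun=> f) f.
Proof. by move=> m; exists 0%N. Qed.

Lemma xs_limD u v f g :
  xs_lim u f -> xs_lim v g -> xs_lim (fun N => u N + v N) (f + g).
Proof.
move=> uf vg m; have [N1 ufm] := uf m; have [N2 vgm] := vg m.
exists (maxn N1 N2) => N; rewrite geq_max => /andP[N1N N2N].
by rewrite /= ufm ?vgm.
Qed.

Lemma xs_limZ c u f : xs_lim u f -> xs_lim (fun N => c *: u N) (c *: f).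
Proof.
by move=> uf m; have [N1 ufm] := uf m; exists N1 => N N1N; rewrite /= ufm.
Qed.

(** A coefficient of a product involves only finitely many coefficients of the
    factors, so that a common rank of stabilization exists. *)
Lemma xs_limM u v f g :
  xs_lim u f -> xs_lim v g -> xs_lim (fun N => u N * v N) (f * g).
Proof.
move=> uf vg m; have [D uD Dm] := covers_ex m.
have [N1 ufD] := xs_lim_seq D uf; have [N2 vgD] := xs_lim_seq D vg.
exists (maxn N1 N2) => N; rewrite geq_max => /andP[N1N N2N].
rewrite -[LHS]/(xs_mul _ _ m) -[RHS]/(xs_mul _ _ m) !(xs_mulE _ _ uD Dm).
rewrite [LHS]big_seq [RHS]big_seq; apply: eq_bigr => a aD.
rewrite [LHS]big_seq_cond [RHS]big_seq_cond; apply: eq_bigr => b /andP[bD _].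
by rewrite ufD ?vgD.
Qed.

Lemma xs_lim_sum (I : eqType) (r : seq I) (u : I -> nat -> xseries K)
    (f : I -> xseries K) :
  {in r, forall i, xs_lim (u i) (f i)} ->
  xs_lim (fun N => \sum_(i <- r) u i N) (\sum_(i <- r) f i).
Proof.
elim: r => [|i r IHr] ur.
  rewrite big_nil (_ : (fun N => _) = fun=> 0); first exact: xs_lim_cst.
  by apply/funext => N; rewrite big_nil.
rewrite big_cons (_ : (fun N => _) = fun N => u i N + \sum_(j <- r) u j N).
  apply: xs_limD; first by apply: ur; rewrite mem_head.
  by apply: IHr => j jr; apply: ur; rewrite inE jr orbT.
by apply/funext => N; rewrite big_cons.
Qed.

End XsLim.

Lemma xs_lim_newton_rec (K : fieldType) (u q : nat -> nat -> xseries K)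
    (U Q : nat -> xseries K) :
  (forall n, xs_lim (u^~ n) (U n)) ->
  (forall k, (0 < k)%N -> xs_lim (q^~ k) (Q k)) ->
  (forall N, newton_rec (u N) (q N)) -> newton_rec U Q.
Proof.
move=> uU qQ uq n n0; apply: (@xs_lim_unique _ (fun N => n%:R *: u N n)).
  exact/xs_limZ/uU.
rewrite (_ : (fun N => _) =
    fun N => \sum_(1 <= k < n.+1) u N (n - k)%N * q N k).
  apply: xs_lim_sum => k; rewrite mem_index_iota => /andP[k0 _].
  by apply: xs_limM; [exact: uU | exact: qQ].
by apply/funext => N; exact: uq.
Qed.

(** When the unknowns start with 1, the recursion expresses q_k polynomially
    through u_1, ..., u_k and q_1, ..., q_(k-1), so that convergence passes from
    [u] to [q].  Applied to the truncated h_n, this provides the limits of the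
    power sums without a separate description of these limits. *)
Lemma newton_rec_xs_lim (K : fieldType) (u q : nat -> nat -> xseries K)
    (U Q : nat -> xseries K) :
  (forall n, xs_lim (u^~ n) (U n)) -> (forall N, u N 0%N = 1) ->
  (forall N, newton_rec (u N) (q N)) -> newton_rec U Q ->
  forall k, (0 < k)%N -> xs_lim (q^~ k) (Q k).
Proof.
move=> uU u1 uq UQ k; have U1 : U 0%N = 1.
  apply: (xs_lim_unique (uU 0%N)); rewrite (_ : u^~ 0%N = fun=> 1).
    exact: xs_lim_cst.
  exact/funext.
have qE (v r : nat -> xseries K) n : v 0%N = 1 -> newton_rec v r ->
    r n.+1 = n.+1%:R *: v n.+1 +
      -1 *: \sum_(1 <= j < n.+1) v (n.+1 - j)%N * r j.
  move=> v1 vr; rewrite vr // big_nat_recr //= subnn v1 mul1r scaleN1r.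
  by rewrite addrAC subrr add0r.
have [p] := ubnP k; elim: p k => // p IHp [//|k] kp _.
rewrite (qE U) // (_ : q^~ k.+1 = fun N => k.+1%:R *: u N k.+1 +
    -1 *: \sum_(1 <= j < k.+1) u N (k.+1 - j)%N * q N j); last first.
  by apply/funext => N; exact: qE.
apply: xs_limD; first exact/xs_limZ/uU.
apply/xs_limZ/xs_lim_sum => j; rewrite mem_index_iota => /andP[j0 jk].
apply: xs_limM; first exact: uU.
by apply: IHp => //; exact: leq_trans jk (ltnSE kp).
Qed.

(** * Partial products of a sprout sequence *)

Section SproutFactor.
Variable K : fieldType.
Implicit Types F G B : fps K.

Lemma sprout_factorM F G i :
  sprout_factor (F * G) i = sprout_factor F i * sprout_factor G i.
Proof.
apply: fpsP => n; rewrite fps_mulE -[LHS]/((F * G) n *: _) fps_mulE scaler_suml.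
apply: eq_bigr => j _ /=; rewrite -scalerAl -scalerAr scalerA -exprD subnKC //.
by rewrite -ltnS.
Qed.

Lemma fps_euler_sprout_factor F i :
  fps_euler (sprout_factor F i) = sprout_factor (fps_euler F) i.
Proof. by apply: fpsP => n /=; rewrite mulr_natl mulr_natl scalerMnl. Qed.

(** This is D P = (sum of the B(x_i t)) P in degree n, for P the product of the
    F(x_i t); the power sums appear as the coefficients of the sum.  The
    assumption on [B 0] excludes the power sum of exponent 0, which diverges. *)
Lemma newton_rec_sprout_prod F B N : B 0%N = 0 -> fps_euler F = B * F ->
  newton_rec (\prod_(i < N) sprout_factor F i : fps _)
    (fun k => B k *: \sum_(i < N) xvar i ^+ k).
Proof.
move=> B0 FB n n0.
pose P : fps (xseries K) := \prod_(i < N) sprout_factor F i.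
pose S : fps (xseries K) := \sum_(i < N) sprout_factor B i.
have PS : fps_euler P = S * P.
  apply: fps_euler_prod => i.
  by rewrite fps_euler_sprout_factor FB sprout_factorM.
have SE k : S k = B k *: \sum_(i < N) xvar i ^+ k.
  by rewrite -[LHS]/(fps_nth k _) raddf_sum scaler_sumr.
rewrite -/P scaler_nat -mulr_natl -[LHS]/(fps_euler P n) PS fps_mulE.
rewrite -(big_mkord xpredT (fun k => S k * P (n - k)%N)) big_nat_recl //.
rewrite SE B0 scale0r mul0r add0r [RHS]big_add1.
by apply: eq_bigr => k _; rewrite SE mulrC.
Qed.

Lemma sprout_prod0 F N : F 0%N = 1 ->
  (\prod_(i < N) sprout_factor F i : fps _) 0%N = 1.
Proof. by move=> F0; apply: fps_prod0 => i; rewrite /= F0 scale1r. Qed.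

End SproutFactor.

(** * The complete homogeneous functions as a sprout sequence *)

Definition fps_geom (K : fieldType) : fps K := Fps (fun=> 1).

Lemma fps_euler_geom (K : fieldType) :
  fps_euler (fps_geom K) = Fps (fun n => (n != 0%N)%:R) * fps_geom K.
Proof.
apply: fpsP => n; rewrite fps_mulE big_ord_recl /= mul0r add0r mulr1.
by rewrite (eq_bigr (fun=> 1)) ?sumr_const ?card_ord // => i _; rewrite mulr1.
Qed.

Section XvarMul.
Variable K : comNzRingType.

Lemma xvarM_nth (i : nat) (f : xseries K) m :
  (xvar i * f) (mmul (ucm i) m) = f m.
Proof.
rewrite -[LHS]/(\sum_(p \in factors _) _).
rewrite -(fsbig_widen [set (ucm i, m)]%classic) /=.
- by rewrite fsbig_set1 /= eqxx mul1r.
- by move=> _ ->.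
move=> [a b] [/= abm abN]; case: eqP => [ai|_]; last by rewrite mul0r.
by case: abN; move: abm; rewrite /factors /= ai => /cmonom_mulI ->.
Qed.

Lemma xvarM_nth0 (i : nat) (f : xseries K) (m : {cmonom nat}) :
  m i = 0%N -> (xvar i * f) m = 0.
Proof.
move=> mi; rewrite -[LHS]/(\sum_(p \in factors _) _).
rewrite fsbig1 // => -[a b] /= abm.
case: eqP => [ai|_]; last by rewrite mul0r.
by move: mi; rewrite -abm cmM ai cmU eqxx.
Qed.

End XvarMul.

Definition vars_below (N : nat) (m : {cmonom nat}) :=
  forall i, (N <= i)%N -> m i = 0%N.

(** Every monomial of degree n in x_0, ..., x_(N-1) occurs exactly once in the
    expansion of the product of the 1 / (1 - x_i t).  The induction on N uses
    that multiplication by the N-th factor amounts to the recurrence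
    G_(n+1) = P_(n+1) + x_N G_n, and splits monomials according to whether x_N
    divides them. *)
Lemma sprout_prod_geom (K : fieldType) N n m :
  (\prod_(i < N) sprout_factor (fps_geom K) i : fps _) n m =
  ((mdeg m == n) && `[< vars_below N m >])%:R.
Proof.
elim: N n m => [|N IHN] n m.
  rewrite big_ord0 /=; case: n => [|n] /=.
    rewrite mdeg_eq0; case: eqP => //= ->.
    by rewrite asboolT // => i _; rewrite cm1.
  case: asboolP; rewrite ?andbF // => m0.
  have /eqP -> : m == mone by apply/cmP => i; rewrite m0 // cm1.
  by rewrite mdeg1.
rewrite -(big_mkord xpredT (sprout_factor _)) big_nat_recr // big_mkord /=.
set P : fps (xseries K) := \prod_(i < N) _ in IHN *.
pose G : fps (xseries K) := P * sprout_factor (fps_geom K) N.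
rewrite -[LHS]/(G n m).
have G0 : G 0%N = P 0%N by rewrite /G fps_mulE big_ord1 /= scale1r mulr1.
(* This is (1 - x_N t) G = P. *)
have GS k : G k.+1 = P k.+1 + xvar N * G k.
  rewrite /G !fps_mulE big_ord_recr subnn [RHS]addrC; congr (_ + _).
    rewrite mulr_sumr; apply: eq_bigr => j _.
    by rewrite /= !scale1r subSn ?exprS 1?mulrCA // -ltnS.
  by rewrite /= scale1r mulr1.
have belowS (m' : {cmonom nat}) : m' N = 0%N ->
    `[< vars_below N.+1 m' >] = `[< vars_below N m' >].
  move=> m'N; apply/asboolP/asboolP => m'0 i.
    by rewrite leq_eqVlt => /predU1P[<-//|]; exact: m'0.
  by move=> /ltnW; exact: m'0.
have PN k m' : (P k) (mmul (ucm N) m') = 0.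
  rewrite IHN; case: asboolP => [/(_ N (leqnn N))|_]; last by rewrite andbF.
  by rewrite cmM cmU eqxx.
elim: n m => [|n IHn] m.
  rewrite G0; case: (posnP (m N)) => [mN|/cmonom_split[m' <-]].
    by rewrite IHN belowS.
  by rewrite PN mdegM mdegU.
rewrite GS -[LHS]/(P n.+1 m + (xvar N * G n) m).
case: (posnP (m N)) => [mN|/cmonom_split[m' <-]].
  by rewrite xvarM_nth0 // addr0 IHN belowS.
rewrite PN add0r xvarM_nth IHn mdegM mdegU add1n eqSS.
congr ((_ && _)%:R); apply/asboolP/asboolP => m0 i Ni.
  by rewrite cmM cmU m0 // ltn_eqF.
by have := m0 i Ni; rewrite cmM cmU ltn_eqF.
Qed.

Lemma vars_below_ex m : exists N0, vars_below N0 m.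
Proof.
exists (\max_(i <- finsupp m) i).+1 => i; rewrite ltnNge => im.
apply/eqP; rewrite cmE_eq0; apply: contra im => im.
exact: leq_bigmax_seq.
Qed.

Lemma hsym_sprout (K : fieldType) : is_sprout (fps_geom K) (hsym K).
Proof.
move=> n m; have [N0 mN0] := vars_below_ex m; exists N0 => N N0N.
rewrite sprout_prod_geom /=; congr (_ %:R); rewrite asboolT ?andbT //.
by move=> i Ni; apply: mN0; exact: leq_trans Ni.
Qed.

Lemma newton_rec_symval (K : fieldType) (u q : nat -> symfun K) :
  newton_rec u q -> newton_rec (fun n => symval (u n)) (fun k => symval (q k)).
Proof. by apply: (@newton_rec_rmorph _ _ _ \val); exact: linearZ_LR. Qed.

(** * The canonical noncommutative lift *)

Theorem theorem5p5 (K : fieldType) (charK0 : [pchar K] =i pred0)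
    (F : fps K) (F0 : F 0%N = 1)
    (R : nat -> symfun K) (sproutR : is_sprout F R)
    (b : nat -> K)
    (logF : fps_log F = Fps (fun n => if n is 0 then 0 else b n / n%:R))
    (phi : {lrmorphism NSym K -> NSym K})
    (phiPsi : forall k : nat, (0 < k)%N -> phi (nsymPsi k) = b k *: nsymPsi k)
    (chi : {lrmorphism NSym K -> symfun K})
    (chiS : forall n : nat, (0 < n)%N -> chi (nsymS n) = hsym K n)
    (n : nat) :
  phi (nsymS n) =
    \sum_(a \in compositions n)
      (comp_coef b a / (pi_u a)%:R) *: nsymPsi_comp a
  /\ chi (phi (nsymS n)) = R n.
Proof.
have PsiS : newton_rec (@nsymS K) nsymPsi by move=> m; exact: nsymPsiE.
have phiS : newton_rec (phi \o nsymS) (fun k => b k *: nsymPsi k).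
  apply: (eq_newton_rec phiPsi).
  by apply: newton_rec_rmorph PsiS; exact: linearZ_LR.
split.
  apply: (newton_rec_unique charK0 _ phiS (newton_rec_comp_sum b charK0)).
  by rewrite comp_sum0 /= rmorph1.
have chiSE m : chi (nsymS m) = hsym K m.
  case: m => [|m]; last exact: chiS.
  rewrite rmorph1; apply/val_inj/xseriesP => m /=.
  by rewrite mdeg_eq0.
pose p k := symval (chi (nsymPsi k)).
pose pN N k : xseries K := \sum_(i < N) xvar i ^+ k.
have hp : newton_rec (fun m => symval (hsym K m)) p.
  have chi_rec := newton_rec_rmorph (@linearZ_LR _ _ _ _ chi) PsiS.
  apply: newton_rec_symval => m m0; rewrite -chiSE chi_rec //.
  by apply: eq_bigr => k _; rewrite /= chiSE.
(* Here F = 1 / (1 - t), for which D (log F) = t / (1 - t). *)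
have pN_lim k : (0 < k)%N -> xs_lim (pN^~ k) (p k).
  apply: (newton_rec_xs_lim (@hsym_sprout K) _ _ hp) => N.
    exact: sprout_prod0.
  apply: eq_newton_rec (newton_rec_sprout_prod N _ (fps_euler_geom K)) => // j.
  by case: j => // j _; rewrite scale1r.
pose b0 j := if j is 0 then 0 else b j.
have FB : fps_euler F = Fps b0 * F.
  rewrite fps_euler_log // logF; congr (_ * _); apply: fpsP => -[|j] /=.
    by rewrite mul0r.
  by rewrite mulrC divfK ?pchar0_natr_neq0.
have Rp : newton_rec (fun m => symval (R m)) (fun k => b k *: p k).
  apply: (@xs_lim_newton_rec _ _ (fun N k => b k *: pN N k) _ _ sproutR).
    by move=> k k0; exact/xs_limZ/pN_lim.
  move=> N; apply: eq_newton_rec (newton_rec_sprout_prod N _ FB) => //.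
  by case.
have R0 : symval (R 0%N) = 1.
  apply: (xs_lim_unique (sproutR 0%N)).
  rewrite (_ : (fun N => _) = fun=> 1); first exact: xs_lim_cst.
  by apply/funext => N; exact: sprout_prod0.
have chiphi : newton_rec (fun m => symval (chi (phi (nsymS m))))
    (fun k => b k *: p k).
  have := newton_rec_symval (newton_rec_rmorph (@linearZ_LR _ _ _ _ chi) phiS).
  apply: eq_newton_rec => k _.
  by rewrite /= linearZ -[LHS]/(\val (b k *: _)) linearZ.
apply: val_inj; apply: (newton_rec_unique charK0 _ chiphi Rp).
by rewrite R0 !rmorph1.
Qed.
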